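(* Let $g:[0,1]\to[0,1]$ be a firm carcass map. Then the complete pre-image of $0$ under $g$, that is the set $g^{-\infty}(0)=\bigcup_{n\geq 1}\{x\in[0,1]: g^n(x)=0\}$, is dense in $[0,1]$.
   Context: Here $g^n$ is the $n$-th iterate of $g$. A unimodal map is a continuous map $g:[0,1]\to[0,1]$ for which there is $v\in(0,1)$ such that $g$ is strictly increasing on $[0,v]$, strictly decreasing on $[v,1]$, and $g(0)=g(1)=0$, $g(v)=1$. A map is piecewise linear if its domain can be divided into finitely many intervals on each of which its graph is a line segment (so ''linear'' means affine). A kink of a piecewise linear map is a point at which it is not differentiable (interior points of $[0,1]$ are meant). A carcass map is a piecewise linear unimodal map. A firm carcass map is a carcass map all of whose kinks belong to the complete pre-image $g^{-\infty}(0)$ of $0$. *)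

(* Defs.v *)
(* The interval [0, 1] lives in an arbitrary realType R and
   self-maps of [0, 1] are functions R -> R whose values outside [0, 1] are
   never used. *)
From mathcomp Require Import all_boot all_order all_algebra.
From mathcomp Require Import all_classical all_reals all_analysis.
Set Implicit Arguments.
Unset Strict Implicit.
Unset Printing Implicit Defensive.
Import Order.TTheory GRing.Theory Num.Theory.
Import numFieldNormedType.Exports.
Local Open Scope classical_set_scope.
Local Open Scope ring_scope.

Record unimodal_map (R : realType) (g : R -> R) : Prop := UnimodalMap {
  unimodal_continuous : {within `[0, 1], continuous g};
  unimodal_range : forall x : R, x \in `[0, 1] -> g x \in `[0, 1];
  unimodal_top : exists v : R,
    [/\ 0 < v < 1,
        {in `[0, v] &, forall x y, x < y -> g x < g y},
        {in `[v, 1] &, forall x y, x < y -> g y < g x},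
        g 0 = 0 /\ g 1 = 0
      & g v = 1] }.

Definition affine_on (R : realType) (A : set R) (g : R -> R) : Prop :=
  exists a b : R, forall x, A x -> g x = a * x + b.

(* [itv_partition 0 1 s] says that 0 :: s is strictly increasing and ends at 1.
   Taking the pieces closed loses nothing, as the maps below are continuous. *)
Definition piecewise_linear (R : realType) (g : R -> R) : Prop :=
  exists s : seq R, itv_partition 0 1 s /\
    forall i, (i < size s)%N ->
      affine_on `[nth 0 (0 :: s) i, nth 0 (0 :: s) i.+1] g.

(* As x is interior to [0, 1], differentiability of g at x only depends on the
   restriction of g to [0, 1]. *)
Definition kink (R : realType) (g : R -> R) (x : R) : Prop :=
  0 < x < 1 /\ ~ derivable g x 1.

Definition complete_preimage0 (R : realType) (g : R -> R) : set R :=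
  \bigcup_(n in [set n | (1 <= n)%N])
    [set x : R | x \in `[0, 1] /\ iter n g x = 0].

Definition carcass_map (R : realType) (g : R -> R) : Prop :=
  unimodal_map g /\ piecewise_linear g.

Definition firm_carcass_map (R : realType) (g : R -> R) : Prop :=
  carcass_map g /\ forall x, kink g x -> complete_preimage0 g x.

(* Main.v *)
Require Import Defs.
From mathcomp Require Import all_boot all_order all_algebra.
From mathcomp Require Import all_classical all_reals all_analysis.
From mathcomp Require Import ring lra.
Import numFieldNormedType.Exports.
Local Open Scope classical_set_scope.
Local Open Scope ring_scope.
Import Order.TTheory GRing.Theory Num.Theory.
Set Implicit Arguments.
Unset Strict Implicit.

(** Let P be the complete pre-image of 0.  It is mapped into itself by g and
contains every pre-image of each of its points.  If P were not dense, some
interval [x, y] with x < y would avoid it.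

Since every kink is in P, and so are 0, 1 and the turning point v, the forward
orbits of these finitely many points form a finite set Q, contained in P and
invariant under g ([firm_carcass_markov]).  Call cells the intervals [p, q]
cut out by Q.  On a cell g is affine with nonzero slope, so g(cell) is an
interval with endpoints in Q, that is, a union of cells.

An interval [x, y] that avoids P avoids Q, hence lies in one cell [p, q]; weigh
it by rho = (y - x) / (q - p), which is at most 1.  Its image again avoids P, so
it lies in one of the cells that make up g([p, q]).  As g is affine on [p, q],
passing to the image within g([p, q]) preserves rho, and replacing g([p, q]) by
a smaller cell increases it.  If the cell is strictly smaller, then its length
is smaller by at least the least distance d between two points of Q, and as
cells have length at most 1, rho is multiplied by at least 1 + d
([preimage_free_step]).

The case in which g maps the cell onto a cell cannot recur forever: it carries
endpoints to endpoints, and all points of Q eventually reach 0, where the two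
endpoints would coincide.  So every interval that avoids P produces another one
with a weight at least 1 + d times larger ([preimage_free_grow]), which is
incompatible with the bound rho <= 1 ([no_preimage_free]). *)

(** * Finite sets of reals *)

Lemma seq_max (R : realType) (s : seq R) (a : R) :
  a \in s -> exists2 p, p \in s & {in s, forall r, r <= p}.
Proof.
elim: s a => // b s IH a _; case: s IH => [|c s] IH.
  by exists b; rewrite ?mem_head// => r; rewrite inE => /eqP->.
have [p ps hp] := IH c (mem_head _ _).
exists (Num.max b p).
  by rewrite maxEle inE; case: ifP; rewrite ?ps ?eqxx ?orbT.
move=> r; rewrite inE => /orP[/eqP->|/hp rp]; rewrite le_max ?lexx //.
by rewrite rp orbT.
Qed.

Lemma seq_min (R : realType) (s : seq R) (a : R) :
  a \in s -> exists2 p, p \in s & {in s, forall r, p <= r}.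
Proof.
move=> /(map_f -%R) /seq_max[p /mapP[q qs ->] hq]; exists q => // r rs.
by rewrite -lerN2 hq// map_f.
Qed.

(** For an invariant set s, this bounds below how much longer the image of a cell
is than any strictly smaller cell in it. *)
Lemma seq_separated (R : realType) (s : seq R) :
  exists2 d, 0 < d & {in s &, forall p q, p < q -> p + d <= q}.
Proof.
(* The extra candidate 1 gives a value of d when s has at most one point. *)
pose D := [seq t <- [seq q - p | p <- s, q <- s] | 0 < t].
have [d dD hd] := seq_min (mem_head 1 D).
exists d; first by move: dD; rewrite inE mem_filter => /orP[/eqP->|/andP[]].
move=> p q ps qs pq; rewrite addrC -lerBrDr; apply: hd.
rewrite inE mem_filter subr_gt0 pq; apply/orP; right; apply/allpairsP.
by exists (p, q).
Qed.

Definition cell (R : realType) (s : seq R) (p q : R) : Prop :=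
  [/\ p \in s, q \in s, p < q & {in s, forall r, r <= p \/ q <= r}].

Lemma cell_around (R : realType) (s : seq R) (a b x : R) :
    a \in s -> b \in s -> a < x < b -> x \notin s ->
  exists p q, cell s p q /\ p < x < q.
Proof.
move=> sa sb /andP[ax xb] xs.
have [|p] := @seq_max R [seq r <- s | r < x] a; first by rewrite mem_filter ax.
rewrite mem_filter => /andP[px ps] hp.
have [|q] := @seq_min R [seq r <- s | x < r] b; first by rewrite mem_filter xb.
rewrite mem_filter => /andP[xq qs] hq.
exists p, q; split; last by rewrite px.
split => //; first exact: lt_trans xq.
move=> r rs; case: (ltgtP r x) => rx.
- by left; apply: hp; rewrite mem_filter rx.
- by right; apply: hq; rewrite mem_filter rx.
- by rewrite -rx rs in xs.
Qed.

(** * Piecewise linear maps between kinks *)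

Lemma affine_on_sub (R : realType) (A B : set R) (g : R -> R) :
  A `<=` B -> affine_on B g -> affine_on A g.
Proof. by move=> AB [a [b h]]; exists a, b => x /AB/h. Qed.

(** Near c the difference quotient is constant on either side, equal to the
slope there; its limit exists, so the two slopes agree. *)
Lemma affine_on_glue (R : realType) (g : R -> R) (a c b : R) :
    a < c < b -> affine_on `[a, c] g -> affine_on `[c, b] g ->
  derivable g c 1 -> affine_on `[a, b] g.
Proof.
move=> /andP[ac cb] [a1 [b1 h1]] [a2 [b2 h2]] dg.
have gc1 : g c = a1 * c + b1 by apply: h1; rewrite /= in_itv /= lexx ltW.
have gc2 : g c = a2 * c + b2 by apply: h2; rewrite /= in_itv /= lexx ltW.
pose f (h : R) := h^-1 *: ((g \o shift c) (h *: 1) - g c).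
have fr : f h @[h --> 0^'+] --> a2.
  apply: cvg_near_cst; near=> h.
  have h0 : 0 < h by near: h; exact: nbhs_right_gt.
  have hb : h < b - c by near: h; apply: nbhs_right_lt; rewrite subr_gt0.
  rewrite /f /= scaler1 h2; last by rewrite /= in_itv /=; lra.
  rewrite gc2 /GRing.scale /=; field; lra.
have fl : f h @[h --> 0^'-] --> a1.
  apply: cvg_near_cst; near=> h.
  have h0 : h < 0 by near: h; exact: nbhs_left_lt.
  have hb : a - c < h by near: h; apply: nbhs_left_gt; rewrite subr_lt0.
  rewrite /f /= scaler1 h1; last by rewrite /= in_itv /=; lra.
  rewrite gc1 /GRing.scale /=; field; lra.
have [e1 e2] : a1 = lim (f h @[h --> 0^']) /\ a2 = lim (f h @[h --> 0^']).
  split; apply/esym.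
    by apply: (cvg_unique _ _ fl) => //; apply: cvg_dnbhs_at_left.
  by apply: (cvg_unique _ _ fr) => //; apply: cvg_dnbhs_at_right.
have e12 : a1 = a2 by rewrite e1 e2.
exists a1, b1 => x; rewrite /= in_itv /= => /andP[ax xb].
have [xc|cx] := leP x c; first by apply: h1; rewrite /= in_itv /= ax.
rewrite h2; last by rewrite /= in_itv /= (ltW cx).
by move: gc1; rewrite gc2 e12 => /addrI ->.
Unshelve. all: by end_near. Qed.

Lemma path_le_last (R : realType) (s : seq R) (a : R) :
  path <%R a s -> a <= last a s.
Proof.
elim: s a => //= b s IH a /andP[ab /IH]; exact: le_trans (ltW ab).
Qed.

(** A break of a subdivision at which g is derivable is spurious.  Intersecting
with [p, q] at each stage of the induction on the subdivision lets the breaks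
outside ]p, q[ be genuine kinks. *)
Lemma affine_on_derivable (R : realType) (g : R -> R) (p q : R) (s : seq R)
    (a : R) :
    path <%R a s ->
    (forall i, (i < size s)%N ->
      affine_on `[nth 0 (a :: s) i, nth 0 (a :: s) i.+1] g) ->
    {in s, forall c, p < c < q -> derivable g c 1} ->
  affine_on [set x | a <= x <= last a s /\ p <= x <= q] g.
Proof.
elim: s a => [|c s IH] a.
  by move=> _ _ _; exists 0, (g a) => x /= [xa _]; rewrite mul0r add0r (le_anti xa).
move=> /= /andP[ac cs] haff hder.
have h1 : affine_on `[a, c] g by apply: (haff 0%N).
have h2 : affine_on [set x | c <= x <= last c s /\ p <= x <= q] g.
  apply: IH => // [i hi|d ds]; first exact: (haff i.+1).
  by apply: hder; rewrite inE ds orbT.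
have cl := path_le_last cs.
have [cp|pc] := leP c p.
  apply: affine_on_sub h2 => x /= [/andP[ax ->] /andP[px ->]].
  by rewrite px (le_trans cp).
have [qc|cq] := leP q c.
  apply: affine_on_sub h1 => x /= [/andP[ax _] /andP[_ xq]].
  by rewrite in_itv /= ax (le_trans xq).
have [lc|clt] := leP (last c s) c.
  apply: affine_on_sub h1 => x /= [/andP[ax xl] _].
  by rewrite in_itv /= ax (le_trans xl).
apply: (@affine_on_sub _ _ `[Num.max a p, Num.min (last c s) q]).
  by move=> x /= [/andP[ax xl] /andP[px xq]]; rewrite in_itv /= ge_max le_min ax xl px.
apply: (@affine_on_glue _ _ _ c).
- by rewrite gt_max lt_min ac pc clt.
- apply: affine_on_sub h1 => x; rewrite /= !in_itv /= ge_max.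
  by move=> /andP[/andP[-> _] ->].
- apply: affine_on_sub h2 => x; rewrite /= !in_itv /= le_min.
  by move=> /andP[cx /andP[-> ->]]; rewrite cx (ltW (lt_le_trans pc cx)).
- by apply: hder; rewrite ?mem_head ?pc.
Qed.

(** * The Markov partition of a firm carcass map *)

Lemma complete_preimage0_0 (R : realType) (g : R -> R) :
  unimodal_map g -> complete_preimage0 g 0.
Proof.
move=> [_ _ [v [_ _ _ [g0 _] _]]].
by exists 1%N => //; split; rewrite //= in_itv /= lexx ler01.
Qed.

Lemma complete_preimage0_map (R : realType) (g : R -> R) (x : R) :
    unimodal_map g ->
  complete_preimage0 g x -> complete_preimage0 g (g x).
Proof.
move=> [_ gI [v [_ _ _ [g0 _] _]]] [n n1 [xI gx]].
by exists n => //; split; [exact: gI | rewrite -iterSr iterS gx].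
Qed.

Lemma complete_preimage0_pull (R : realType) (g : R -> R) (x : R) :
  x \in `[0, 1] -> complete_preimage0 g (g x) -> complete_preimage0 g x.
Proof. by move=> xI [n n1 [_ gx]]; exists n.+1 => //; split; rewrite // iterSr. Qed.

(** The orbit of a point of the complete pre-image is finite, as it stops at the
fixed point 0. *)
Lemma invariant_hull (R : realType) (g : R -> R) (B : seq R) :
    unimodal_map g -> {in B, forall x, complete_preimage0 g x} ->
  exists Q : seq R, [/\ {subset B <= Q}, 0 \in Q,
    {in Q, forall x, complete_preimage0 g x} & {in Q, forall x, g x \in Q}].
Proof.
move=> ug; have [_ _ [v [_ _ _ [g0 _] _]]] := ug.
elim: B => [|b B IH] hB.
  exists [:: 0]; split => [//||x|x]; rewrite ?mem_head // inE => /eqP->.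
    exact: complete_preimage0_0.
  by rewrite g0 mem_head.
have [|Q [BQ Q0 QP Qg]] := IH; first by move=> x xB; apply: hB; rewrite inE xB orbT.
have bP := hB b (mem_head _ _); have [n n1 [bI gb]] := bP.
exists (traject g b n ++ Q); split.
- move=> x; rewrite inE mem_cat => /orP[/eqP->|/BQ ->]; last by rewrite orbT.
  by apply/orP; left; apply/trajectP; exists 0%N.
- by rewrite mem_cat Q0 orbT.
- move=> x; rewrite mem_cat => /orP[/trajectP[i _ ->]|/QP//].
  by elim: i => //= i; exact: complete_preimage0_map.
- move=> x; rewrite !mem_cat => /orP[/trajectP[i ilt ->]|/Qg ->]; last by rewrite orbT.
  have [lt|ge] := ltnP i.+1 n; first by apply/orP; left; apply/trajectP; exists i.+1.
  suff -> : g (iter i g b) = 0 by rewrite Q0 orbT.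
  by rewrite -iterS (_ : i.+1 = n)//; apply/eqP; rewrite eqn_leq ilt ge.
Qed.

(** The slope of g on a cell being nonzero, g maps each cell onto a union of
cells, which is the usual Markov property. *)
Record markov_partition (R : realType) (g : R -> R) (Q : seq R) : Prop :=
  MarkovPartition {
    markov_0 : 0 \in Q;
    markov_1 : 1 \in Q;
    markov_preimage : {in Q, forall x, complete_preimage0 g x};
    markov_map : {in Q, forall x, g x \in Q};
    markov_affine : forall p q, cell Q p q -> exists a b,
      a != 0 /\ forall x, p <= x <= q -> g x = a * x + b }.

(** The orbits of 1, of the turning point and of the breaks that lie in the
complete pre-image suffice: the other breaks are not kinks, because g is firm,
so g is affine on each cell.  The slope is not 0, as no cell contains the
turning point in its interior, which makes g strictly monotone there. *)
Lemma firm_carcass_markov (R : realType) (g : R -> R) :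
  firm_carcass_map g -> exists Q, markov_partition g Q.
Proof.
move=> [[ug [s [/= [sp /eqP sl] saff]]] gk].
have [_ gI [v [/andP[v0 v1] ginc gdec [g0 g1] gv]]] := ug.
pose B := 1 :: v :: [seq c <- s | `[< complete_preimage0 g c >]].
have [|Q [BQ Q0 QP Qg]] := @invariant_hull R g B ug.
  move=> x; rewrite !inE mem_filter => /or3P[/eqP->|/eqP->|/andP[/asboolP]//].
    by exists 1%N => //; split; rewrite // in_itv /= lexx ler01.
  by exists 2%N => //; split; rewrite /= ?gv // in_itv /= !ltW.
have Q1 : 1 \in Q by apply: BQ; rewrite mem_head.
have Qv : v \in Q by apply: BQ; rewrite !inE eqxx orbT.
exists Q; split => // p q [pQ qQ pq hpq].
have [n _ [+ _]] := QP p pQ; rewrite in_itv /= => /andP[p0 p1].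
have [m _ [+ _]] := QP q qQ; rewrite in_itv /= => /andP[q0 q1].
have : affine_on [set x | 0 <= x <= last 0 s /\ p <= x <= q] g.
  apply: affine_on_derivable => // c cs /andP[pc cq].
  apply: contrapT => nd.
  have cQ : c \in Q.
    apply: BQ; rewrite !inE mem_filter cs andbT; apply/or3P/Or33/asboolP/gk.
    by split => //; rewrite (le_lt_trans p0)// (lt_le_trans cq).
  by have [] := hpq c cQ; rewrite leNgt ?pc ?cq.
move=> [a [b hab]].
have gE x : p <= x <= q -> g x = a * x + b.
  move=> /andP[px xq]; apply: hab => /=; rewrite sl px xq.
  by rewrite (le_trans p0)// (le_trans xq).
exists a, b; split => //; apply/eqP => a0.
have gpq : g p = g q by rewrite !gE ?lexx ?(ltW pq)// a0 !mul0r.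
have [vp|qv] := hpq v Qv.
  have := gdec p q; rewrite !in_itv /= vp p1 q1 (le_trans vp (ltW pq)) gpq ltxx.
  by move/(_ isT isT pq).
have := ginc p q; rewrite !in_itv /= p0 q0 qv (le_trans (ltW pq) qv) gpq ltxx.
by move/(_ isT isT pq).
Qed.

(** * Expansion of the intervals that avoid the complete pre-image *)

Definition preimage_free (R : realType) (g : R -> R) (x y : R) : Prop :=
  [/\ 0 <= x, x < y, y <= 1 & forall t, x <= t <= y -> ~ complete_preimage0 g t].

Lemma preimage_free_cell (R : realType) (g : R -> R) (Q : seq R) (x y : R) :
    markov_partition g Q -> preimage_free g x y ->
  exists p q, [/\ cell Q p q, p < x & y < q].
Proof.
move=> [Q0 Q1 QP _ _] [x0 xy y1 free].
have xQ : x \notin Q by apply/negP => /QP; apply: free; rewrite lexx ltW.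
have xn0 : 0 < x by rewrite lt_neqAle x0 andbT; apply: contraNneq xQ => <-.
have [|p [q [pqc /andP[px xq]]]] := cell_around Q0 Q1 _ xQ.
  by rewrite xn0 (lt_le_trans xy).
exists p, q; split => //; rewrite ltNge; apply/negP => qy.
have [_ qQ _ _] := pqc.
by apply: (free q); rewrite ?(ltW xq)//; exact: QP.
Qed.

(** The common part of the two orientations in [preimage_free_step].  Here [u, w]
is the image of a cell of length l, and [x, y] the image in it of an interval
of length m; e says that g scales both by the same factor.  The bound is the
growth of the weight, with denominators cleared. *)
Lemma cell_in_image (R : realType) (g : R -> R) (Q : seq R) (d l m u x y w : R) :
    markov_partition g Q -> {in Q &, forall p q, p < q -> p + d <= q} ->
    0 < d -> u \in Q -> w \in Q -> u < x -> y < w -> preimage_free g x y ->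
    0 < l -> 0 < m -> (y - x) * l = m * (w - u) ->
  exists p q, [/\ cell Q p q, p < x, y < q &
    (1 + d) * (m * (q - p)) <= (y - x) * l \/ (p = u /\ q = w)].
Proof.
move=> mg Qd d0 uQ wQ ux yw free l0 m0 e.
have [p [q [pqc px yq]]] := preimage_free_cell mg free.
exists p, q; split => //.
have [pQ qQ pq hpq] := pqc; have [x0 xy y1 _] := free.
have qp1 : q - p <= 1.
  have [n _ [+ _]] := markov_preimage mg pQ; rewrite in_itv /= => /andP[p0 _].
  have [k _ [+ _]] := markov_preimage mg qQ; rewrite in_itv /= => /andP[_ q1].
  lra.
have up : u <= p by have [//|qu] := hpq u uQ; lra.
have qw : q <= w by have [wp|//] := hpq w wQ; lra.
(* As q - p <= 1, an excess of length d is at least d * (q - p), which turns an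
   additive gain into a factor 1 + d. *)
have dqp : 0 <= d * (1 - (q - p)) by rewrite mulr_ge0 ?subr_ge0 // ltW.
have [pu|pnu] := eqVneq p u; last first.
  left; rewrite e mulrCA ler_pM2l//.
  have := Qd u p uQ pQ; rewrite lt_neqAle eq_sym pnu up => /(_ isT); lra.
have [qw'|qnw] := eqVneq q w; first by right.
left; rewrite e mulrCA ler_pM2l//.
have := Qd q w qQ wQ; rewrite lt_neqAle qnw qw => /(_ isT); lra.
Qed.

(** The weight of an interval relative to its cell either grows by the factor
1 + d or stays the same; it stays the same only if g maps the cell onto a cell,
and then new endpoints are images of old ones, in either order. *)
Lemma preimage_free_step (R : realType) (g : R -> R) (Q : seq R)
    (d p q x y : R) :
    unimodal_map g ->
    markov_partition g Q -> {in Q &, forall p q, p < q -> p + d <= q} ->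
    0 < d -> cell Q p q -> p < x -> y < q -> preimage_free g x y ->
  exists x' y' p' q', [/\ preimage_free g x' y', cell Q p' q', p' < x', y' < q' &
    (1 + d) * ((y - x) / (q - p)) <= (y' - x') / (q' - p') \/
    [/\ (y' - x') / (q' - p') = (y - x) / (q - p), p' = g p \/ p' = g q &
        q' = g p \/ q' = g q]].
Proof.
move=> ug mg Qd d0 pqc px yq free.
have [pQ qQ pq hpq] := pqc; have [x0 xy y1 hfree] := free.
have [a [b [an0 gE]]] := markov_affine mg pqc.
have gx : g x = a * x + b by apply: gE; lra.
have gy : g y = a * y + b by apply: gE; lra.
have gp : g p = a * p + b by apply: gE; lra.
have gq : g q = a * q + b by apply: gE; lra.
have gI := unimodal_range ug.
have := gI x; rewrite !in_itv /= => /(_ ltac:(lra)) gxI.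
have := gI y; rewrite !in_itv /= => /(_ ltac:(lra)) gyI.
have gfree t : x <= (t - b) / a <= y -> ~ complete_preimage0 g t.
  move=> tI tP; apply: (hfree _ tI); apply: complete_preimage0_pull.
    by rewrite in_itv /=; lra.
  rewrite gE; last lra.
  by rewrite mulrC divfK// subrK.
have xy0 : 0 < y - x by rewrite subr_gt0.
have qp0 : 0 < q - p by rewrite subr_gt0.
have ratio X Y P' Q' : cell Q P' Q' -> (Y - X) * (q - p) = (y - x) * (Q' - P') ->
    (Y - X) / (Q' - P') = (y - x) / (q - p).
  by move=> [_ _ PQ _] h; apply/eqP; rewrite eqr_div ?h//; lra.
have ratio_le X Y P' Q' : cell Q P' Q' ->
    (1 + d) * ((y - x) * (Q' - P')) <= (Y - X) * (q - p) ->
    (1 + d) * ((y - x) / (q - p)) <= (Y - X) / (Q' - P').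
  move=> [_ _ PQ _] h; have PQ0 : 0 < Q' - P' by rewrite subr_gt0.
  by rewrite ler_pdivlMr// mulrA mulrAC ler_pdivrMr// -mulrA.
case: (ltgtP 0 a) => [a0|a0|a0]; last by rewrite a0 eqxx in an0.
- have free' : preimage_free g (g x) (g y).
    split; [lra | nra | lra | ] => t /andP[xt ty]; apply: gfree.
    by rewrite ler_pdivlMr// ler_pdivrMr//; lra.
  have [|||P' [Q' [c P'x yQ' h]]] := @cell_in_image R g Q d (q - p) (y - x)
    (g p) (g x) (g y) (g q) mg Qd d0 (markov_map mg pQ) (markov_map mg qQ)
    _ _ free' qp0 xy0.
  + nra.
  + nra.
  + by rewrite gx gy gp gq; ring.
  + exists (g x), (g y), P', Q'; split => //.
    case: h => [h|[eP eQ]]; [by left; exact: ratio_le | right].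
    split; [|by left|by right]; apply: ratio => //.
    by rewrite eP eQ gx gy gp gq; ring.
- have free' : preimage_free g (g y) (g x).
    split; [lra | nra | lra | ] => t /andP[xt ty]; apply: gfree.
    by rewrite ler_ndivlMr// ler_ndivrMr//; lra.
  have [|||P' [Q' [c P'x yQ' h]]] := @cell_in_image R g Q d (q - p) (y - x)
    (g q) (g y) (g x) (g p) mg Qd d0 (markov_map mg qQ) (markov_map mg pQ)
    _ _ free' qp0 xy0.
  + nra.
  + nra.
  + by rewrite gx gy gp gq; ring.
  + exists (g y), (g x), P', Q'; split => //.
    case: h => [h|[eP eQ]]; [by left; exact: ratio_le | right].
    split; [|by right|by left]; apply: ratio => //.
    by rewrite eP eQ gx gy gp gq; ring.
Qed.

(** The integer n, which bounds the time at which the endpoints of the cell reach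
0, drops with each step that does not increase the weight.  It cannot drop to 0,
where p and q would be equal. *)
Lemma preimage_free_grow (R : realType) (g : R -> R) (Q : seq R)
    (d : R) (n : nat) (p q x y : R) :
    unimodal_map g ->
    markov_partition g Q -> {in Q &, forall p q, p < q -> p + d <= q} ->
    0 < d -> cell Q p q -> p < x -> y < q -> preimage_free g x y ->
    iter n g p = 0 -> iter n g q = 0 ->
  exists x' y' p' q', [/\ preimage_free g x' y', cell Q p' q', p' < x', y' < q' &
    (1 + d) * ((y - x) / (q - p)) <= (y' - x') / (q' - p')].
Proof.
move=> ug mg Qd d0; elim: n p q x y => [|n IH] p q x y pqc px yq free.
  by move=> /= p0 q0; case: pqc; rewrite p0 q0 ltxx.
rewrite !iterSr => gp gq.
have [x' [y' [p' [q' [free' c px' yq' h]]]]] :=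
  preimage_free_step ug mg Qd d0 pqc px yq free.
case: h => [h|[<- hp hq]]; first by exists x', y', p', q'.
apply: (IH p' q') => //; first by case: hp => ->.
by case: hq => ->.
Qed.

(** The supremum of all weights is finite and positive, but the factor 1 + d
bounds every weight by that supremum divided by 1 + d. *)
Lemma no_preimage_free (R : realType) (g : R -> R) (x y : R) :
  firm_carcass_map g -> ~ preimage_free g x y.
Proof.
move=> fg free; have ug := fg.1.1.
have [_ _ [v [_ _ _ [g0 _] _]]] := ug.
have [Q mg] := firm_carcass_markov fg.
have [d d0 Qd] := seq_separated Q.
pose S := [set r : R | exists x y p q, [/\ preimage_free g x y, cell Q p q,
  p < x, y < q & r = (y - x) / (q - p)]].
have S1 : ubound S 1.
  move=> _ [x1 [y1 [p [q [[_ xy _ _] [_ _ pq _] px yq ->]]]]].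
  by rewrite ler_pdivrMr ?subr_gt0//; lra.
have [p [q [c px yq]]] := preimage_free_cell mg free.
have Sr : S ((y - x) / (q - p)) by exists x, y, p, q.
have r0 : 0 < (y - x) / (q - p).
  by have [_ xy _ _] := free; apply: divr_gt0; lra.
have Sb : has_ubound S by exists 1.
have rS := ub_le_sup Sb Sr.
suff : sup S <= sup S / (1 + d) by rewrite ler_pdivlMr; [nra | lra].
apply: ge_sup; first by exists ((y - x) / (q - p)).
move=> _ [x1 [y1 [p1 [q1 [free1 c1 px1 yq1 ->]]]]].
have [p1Q q1Q _ _] := c1.
have [n _ [_ gp]] := markov_preimage mg p1Q.
have [m _ [_ gq]] := markov_preimage mg q1Q.
have it0 k : iter k g 0 = 0 by elim: k => //= k ->.
have [||x2 [y2 [p2 [q2 [free2 c2 px2 yq2 h]]]]] :=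
  @preimage_free_grow R g Q d (n + m) p1 q1 x1 y1 ug mg Qd d0 c1 px1 yq1 free1.
- by rewrite addnC iterD gp it0.
- by rewrite iterD gq it0.
rewrite ler_pdivlMr; last lra.
rewrite mulrC (le_trans h)//; apply: ub_le_sup => //.
by exists x2, y2, p2, q2.
Qed.

Theorem theorem2 (R : realType) (g : R -> R) (hg : firm_carcass_map g) :
  `[0, 1] `<=` closure (complete_preimage0 g).
Proof.
move=> z /=; rewrite in_itv /= => /andP[z0 z1].
apply: contrapT => /existsNP[V /not_implyP[/nbhs_ballP[e /= e0 eV] VP]].
have free t : ball z e t -> ~ complete_preimage0 g t.
  by move=> zt tP; apply: VP; exists t; split => //; exact: eV.
have zn0 : 0 < z.
  rewrite lt_neqAle z0 andbT; apply/eqP => zE; apply: (free z); first exact: ballxx.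
  by rewrite -zE; exact: complete_preimage0_0 hg.1.1.
(* Extending to the left of z stays in [0, 1] since 0 is in the pre-image. *)
apply: (@no_preimage_free R g (Num.max 0 (z - e / 2)) z hg); split => //.
- by rewrite le_max lexx.
- by rewrite gt_max zn0; lra.
- move=> t; rewrite ge_max => /andP[/andP[t0 zt] tz]; apply: free.
  by rewrite /ball /= ger0_norm; lra.
Qed.
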